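(* Let $\mathbb{F}$ be any field, $k\in\mathbb{Z}_{\ge2}$ and $F\in\Delta(\mathbb{F},k)$. Then the set of values $\{F(T):T\in\mathbb{F}^{d_1}\otimes\cdots\otimes\mathbb{F}^{d_k},\ d\in\mathbb{Z}_{\ge1}^k\}$ is well-ordered (every nonempty subset has a smallest element; equivalently every non-increasing sequence in it is eventually constant).
   Context: For $k$-tensors $S\in V_1\otimes\cdots\otimes V_k$ and $T\in W_1\otimes\cdots\otimes W_k$, $S$ is a restriction of $T$, written $S\le T$, if there are linear maps $A_i\colon W_i\to V_i$ with $S=(A_1\otimes\cdots\otimes A_k)T$. The Kronecker product $S\boxtimes T\in (V_1\otimes W_1)\otimes\cdots\otimes(V_k\otimes W_k)$ is $S\otimes T$ with corresponding legs grouped, and the direct sum $S\oplus T\in(V_1\oplus W_1)\otimes\cdots\otimes(V_k\oplus W_k)$ is the block-diagonal sum. For $r\in\mathbb{N}$, the unit tensor is $\langle r\rangle=\sum_{i=1}^r e_i\otimes\cdots\otimes e_i\in(\mathbb{F}^r)^{\otimes k}$. The asymptotic spectrum $\Delta(\mathbb{F},k)$ is the set of all functions $F$ from $k$-tensors over $\mathbb{F}$ (of all formats) to $\mathbb{R}_{\ge0}$ such that $F(S\boxtimes T)=F(S)F(T)$, $F(S\oplus T)=F(S)+F(T)$, $F(\langle r\rangle)=r$ for all $r\in\mathbb{N}$, and $S\le T$ implies $F(S)\le F(T)$. *)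

(* Defs.v *)
From HB Require Import structures.
From mathcomp Require Import all_boot all_order all_algebra.
From mathcomp Require Import mxtens.
From mathcomp Require Import classical_sets reals.

Set Implicit Arguments.
Unset Strict Implicit.
Unset Printing Implicit Defensive.

Import Order.TTheory GRing.Theory Num.Theory.
Local Open Scope classical_set_scope.
Local Open Scope ring_scope.

(* Tensors are given in coordinates: an element of K^(d 0) (x) ... (x) K^(d k.-1)
   is its array of coefficients in the product basis, indexed by multi_index d.
   A dimension d i may be 0. *)
Definition format (k : nat) := 'I_k -> nat.

Definition multi_index (k : nat) (d : format k) :=
  {dffun forall i : 'I_k, 'I_(d i)}.

Definition tensor (K : fieldType) (k : nat) (d : format k) :=
  {ffun multi_index d -> K}.

Section Operations.
Variables (K : fieldType) (k : nat).
Implicit Types d e : format k.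

(* (A_1 (x) ... (x) A_k) T, where A i sends a column vector v to A i *m v. *)
Definition apply_legs d e (A : forall i, 'M[K]_(d i, e i)) (T : tensor K e) :
    tensor K d :=
  [ffun x : multi_index d =>
     \sum_(y : multi_index e) (\prod_(i < k) A i (x i) (y i)) * T y].

Definition restriction d e (S : tensor K d) (T : tensor K e) : Prop :=
  exists A : forall i, 'M[K]_(d i, e i), S = apply_legs A T.

(* The basis vector e_a (x) e_b of K^m (x) K^n is identified with the basis
   vector of K^(m * n) of index mxtens_index (a, b). *)
Definition kronecker d e (S : tensor K d) (T : tensor K e) :
    tensor K (fun i => (d i * e i)%N) :=
  [ffun x : multi_index (fun i => (d i * e i)%N) =>
     S [ffun i => (mxtens_unindex (x i)).1] *
     T [ffun i => (mxtens_unindex (x i)).2]].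

Definition direct_sum d e (S : tensor K d) (T : tensor K e) :
    tensor K (fun i => (d i + e i)%N) :=
  [ffun x : multi_index (fun i => (d i + e i)%N) =>
     \sum_(y : multi_index d | [forall i, x i == lshift (e i) (y i)]) S y +
     \sum_(z : multi_index e | [forall i, x i == rshift (d i) (z i)]) T z].

Definition unit_tensor (r : nat) : tensor K (fun _ : 'I_k => r) :=
  [ffun x : multi_index (fun _ : 'I_k => r) =>
     \sum_(j < r) \prod_(i < k) (x i == j)%:R].

End Operations.

Definition asymptotic_spectrum (R : realType) (K : fieldType) (k : nat) :
    set (forall d : format k, tensor K d -> R) :=
  [set F | [/\ forall d (T : tensor K d), 0 <= F d T,
    forall d e (S : tensor K d) (T : tensor K e),
      F _ (kronecker S T) = F d S * F e T,
    forall d e (S : tensor K d) (T : tensor K e),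
      F _ (direct_sum S T) = F d S + F e T,
    forall r : nat, F _ (unit_tensor K k r) = r%:R &
    forall d e (S : tensor K d) (T : tensor K e),
      restriction S T -> F d S <= F e T]].

Arguments asymptotic_spectrum : clear implicits.

Definition tensor_values (R : realType) (K : fieldType) (k : nat)
    (F : forall d : format k, tensor K d -> R) : set R :=
  [set v | exists (d : format k) (T : tensor K d),
     (forall i, (1 <= d i)%N) /\ v = F d T].

(* Main.v *)
(* For a fixed format, tensors with [F <= r] are the zero locus of polynomials:
   if every polynomial vanishing on them vanishes at [T], then the n-th Kronecker
   power of [T] is a linear combination of polynomially many (in n) n-th powers
   of such tensors, so [F T ^ n <= poly n * r ^ n] by subadditivity of [F], and
   [F T <= r].  By Hilbert's basis theorem there is no strictly decreasing
   sequence of values in a fixed format.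
   Tensors with [F <= r] can be brought to one common format.  If [F] is 1 on all
   EPR pairs (identity matrices shared by two legs) between legs i and j, then by
   teleportation leg i can be merged into leg j without changing [F].  Once all
   such merges are done, [F] is unbounded on EPR pairs between any two remaining
   legs.  If the flattening of [T] along a remaining leg has large rank, then [T]
   restricts to a large EPR pair between this leg and another remaining one,
   hence [F T] is large.  So [F T <= r] bounds all the flattening ranks, and
   thereby the format. *)
Require Import Defs.
From mathcomp Require Import all_boot all_order all_algebra.
From mathcomp Require Import mxtens lra.
From mathcomp Require Import boolp reals.

Set Implicit Arguments.
Unset Strict Implicit.
Unset Printing Implicit Defensive.

Import Order.TTheory GRing.Theory Num.Theory.
Local Open Scope ring_scope.

(** * Hilbert's basis theorem *)

Section Hilbert.

Definition in_ideal (A : comNzRingType) (s : seq A) (f : A) : Prop :=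
  exists c : nat -> A, f = \sum_(i < size s) c i * s`_i.

(** Ascending chain condition, stated on sequences of generators so that ideals need not be
    objects. *)
Definition noetherian (A : comNzRingType) : Prop :=
  forall a : nat -> A, exists n, in_ideal (mkseq a n) (a n).

Lemma in_ideal_add (A : comNzRingType) (s : seq A) f g :
  in_ideal s f -> in_ideal s g -> in_ideal s (f + g).
Proof.
move=> [c ->] [e ->]; exists (fun i => c i + e i).
by rewrite -big_split; apply: eq_bigr => i _; rewrite mulrDl.
Qed.

Lemma in_ideal_mul (A : comNzRingType) (s : seq A) f g :
  in_ideal s f -> in_ideal s (g * f).
Proof.
move=> [c ->]; exists (fun i => g * c i).
by rewrite mulr_sumr; apply: eq_bigr => i _; rewrite mulrA.
Qed.

Lemma in_ideal_sum (A : comNzRingType) (s : seq A) n (c f : nat -> A) :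
  (forall i, (i < n)%N -> in_ideal s (f i)) ->
  in_ideal s (\sum_(i < n) c i * f i).
Proof.
move=> sf; elim/big_ind: _ => [|g h|i _].
- by exists (fun=> 0); rewrite big1 // => i _; rewrite mul0r.
- exact: in_ideal_add.
- by apply: in_ideal_mul; apply: sf.
Qed.

Lemma in_ideal_mem (A : comNzRingType) (s : seq A) i :
  (i < size s)%N -> in_ideal s s`_i.
Proof.
move=> si; exists (fun j => (j == i)%:R).
rewrite (bigD1 (Ordinal si)) //= eqxx mul1r big1 ?addr0 // => j /negbTE.
by rewrite -val_eqE /= => ->; rewrite mul0r.
Qed.

Lemma in_ideal_trans (A : comNzRingType) (s t : seq A) f :
  in_ideal s f -> (forall i, (i < size s)%N -> in_ideal t s`_i) -> in_ideal t f.
Proof. by move=> [c ->] st; apply: (in_ideal_sum c). Qed.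

Lemma in_ideal_mkseq (A : comNzRingType) (a : nat -> A) i n :
  (i < n)%N -> in_ideal (mkseq a n) (a i).
Proof.
move=> lin; rewrite -(nth_mkseq 0 a lin); apply: in_ideal_mem.
by rewrite size_mkseq.
Qed.

Lemma in_ideal_mkseq_le (A : comNzRingType) (a : nat -> A) m n f :
  (m <= n)%N -> in_ideal (mkseq a m) f -> in_ideal (mkseq a n) f.
Proof.
move=> mn /in_ideal_trans; apply=> i; rewrite size_mkseq => im.
by rewrite nth_mkseq //; apply: in_ideal_mkseq; apply: leq_trans mn.
Qed.

Lemma noetherian_field (L : fieldType) : noetherian L.
Proof.
move=> a; have [a0|a0] := eqVneq (a 0) 0.
  by exists 0, (fun=> 0); rewrite big_ord0.
by exists 1, (fun=> a 1 / a 0); rewrite big_ord1 /= divfK.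
Qed.

(* An increasing choice of elements of minimal degree outside the ideal
   generated so far; their leading coefficients contradict noetherianity. *)
Lemma noetherian_poly (A : comNzRingType) : noetherian A -> noetherian {poly A}.
Proof.
move=> nA a; apply: contrapT => /forallNP nota.
pose I f := exists n, in_ideal (mkseq a n) f.
have I_big n (f : nat -> {poly A}) : (forall i, (i < n)%N -> I (f i)) ->
    exists N, forall i, (i < n)%N -> in_ideal (mkseq a N) (f i).
  elim: n => [|n IHn] If; first by exists 0.
  have [i lin|N hN] := IHn; first by apply: If; apply: ltnW.
  have [M hM] := If n (ltnSn n); exists (maxn N M) => i.
  rewrite ltnS leq_eqVlt => /orP[/eqP->|lin].
    exact: in_ideal_mkseq_le (leq_maxr _ _) hM.
  exact: in_ideal_mkseq_le (leq_maxl _ _) (hN _ lin).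
have step (s : seq {poly A}) : exists f, (forall i, (i < size s)%N -> I s`_i) ->
    [/\ I f, ~ in_ideal s f &
     forall g, I g -> ~ in_ideal s g -> (size f <= size g)%N].
  have [sI|] := pselect (forall i, (i < size s)%N -> I s`_i); last by exists 0.
  have [N hN] := I_big _ _ sI.
  pose P n := `[< exists f, [/\ I f, ~ in_ideal s f & size f = n] >].
  have exP : exists n, P n.
    exists (size (a N)); apply/asboolP; exists (a N); split=> //.
      by exists N.+1; apply: in_ideal_mkseq.
    by move=> sa; apply: (nota N); apply: in_ideal_trans sa _.
  have [n /asboolP[f [If sf <-]] minf] := ex_minnP exP.
  exists f => _; split=> // g Ig sg; apply: minf; apply/asboolP.
  by exists g.
have [pick pickP] := choice step.
pose l n := iter n (fun s => rcons s (pick s)) [::].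
pose f n := pick (l n).
have lE n : l n = mkseq f n by elim: n => // n IHn; rewrite mkseqS -IHn.
have fI n : I (f n).
  elim/ltn_ind: n => n IHn; rewrite /f lE.
  have [] // := pickP (mkseq f n) => i; rewrite size_mkseq => lin.
  by rewrite nth_mkseq //; apply: IHn.
have fP n : ~ in_ideal (mkseq f n) (f n) /\
    (forall g, I g -> ~ in_ideal (mkseq f n) g -> (size (f n) <= size g)%N).
  have fnE : f n = pick (mkseq f n) by rewrite -lE.
  have [i|_ nf minf] := pickP (mkseq f n); last by rewrite fnE.
  by rewrite size_mkseq => lin; rewrite nth_mkseq.
have f_mono i n : (i <= n)%N -> (size (f i) <= size (f n))%N.
  move=> lin; have [_] := fP i; apply; first exact: fI.
  by move=> fin; have [+ _] := fP n; apply; apply: in_ideal_mkseq_le fin.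
have [n [c]] := nA (fun n => lead_coef (f n)).
rewrite size_mkseq => cE; have [nf minf] := fP n.
have f0 i : f i != 0.
  apply/eqP => fi0; have [+ _] := fP i; apply; rewrite fi0.
  by exists (fun=> 0); rewrite big1 // => j _; rewrite mul0r.
(* [h] lies in the ideal of the earlier elements and has the leading term of [f n], so [f n - h] is
   outside that ideal but of smaller size, against minimality. *)
pose h := \sum_(i < n) ((c i)%:P * 'X^(size (f n) - size (f i))) * f i.
have hI : in_ideal (mkseq f n) h.
  apply: (in_ideal_sum (fun i => (c i)%:P * 'X^(size (f n) - size (f i)))).
  by move=> i; apply: in_ideal_mkseq.
have Ig : I (f n - h).
  have [N hN] := I_big n.+1 f (fun i _ => fI i).
  exists N; rewrite -mulN1r; apply: in_ideal_add; first exact: hN.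
  apply: in_ideal_mul; apply: in_ideal_trans hI _ => i.
  by rewrite size_mkseq => lin; rewrite nth_mkseq //; apply: hN; apply: ltnW.
have: ~ in_ideal (mkseq f n) (f n - h).
  by move=> gI; apply: nf; rewrite -(subrK h (f n)); apply: in_ideal_add.
move/(minf _ Ig); rewrite leqNgt => /negP; apply.
have fn_gt0 : (0 < size (f n))%N by rewrite size_poly_gt0.
have hcoef j : ((size (f n)).-1 <= j)%N -> (f n - h)`_j = 0.
  move=> hj; rewrite coefB coef_sum.
  have [jE|jN] := eqVneq j (size (f n)).-1.
    rewrite jE -lead_coefE cE; apply/eqP; rewrite subr_eq0; apply/eqP.
    apply: eq_bigr => i _; rewrite nth_mkseq // -mulrA coefCM coefXnM.
    have lein : (size (f i) <= size (f n))%N by apply: f_mono; apply: ltnW.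
    have i_gt0 : (0 < size (f i))%N by rewrite size_poly_gt0.
    rewrite ltnNge -(subn1 (size (f n))) leq_sub2l //= lead_coefE; congr (_ * _`_ _).
    by rewrite -!subn1 subnAC subKn.
  have lj : (size (f n) <= j)%N.
    by rewrite -(prednK fn_gt0) ltn_neqAle eq_sym jN.
  rewrite nth_default // big1 ?subr0 // => i _.
  rewrite -mulrA coefCM coefXnM.
  have lein : (size (f i) <= size (f n))%N by apply: f_mono; apply: ltnW.
  rewrite ltnNge (leq_trans (leq_subr _ _) lj) /= nth_default ?mulr0 //.
  by rewrite leq_subRL ?(leq_trans (leq_subr _ _) lj) // subnK.
rewrite -[ltnRHS](prednK fn_gt0) ltnS; apply/leq_sizeP => j; exact: hcoef.
Qed.

(** Iterated [{poly A}] stands in for polynomials in [n] variables; only constants and coordinates,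
    represented uniformly in the point, are needed. *)
Lemma noetherian_evaluation (L : fieldType) (n : nat) :
  exists (A : comNzRingType) (ev : (nat -> L) -> {rmorphism A -> L}),
    [/\ noetherian A, forall c, exists p, forall x, ev x p = c &
        forall i, (i < n)%N -> exists p, forall x, ev x p = x i].
Proof.
elim: n => [|n [A [ev [nA evC evX]]]].
  exists L, (fun=> idfun); split=> // [|c]; first exact: noetherian_field.
  by exists c.
exists {poly A}, (fun x => horner_eval (x n) \o map_poly (ev x)); split.
- exact: noetherian_poly.
- move=> c; have [p pE] := evC c; exists p%:P => x /=.
  by rewrite map_polyC /= pE /horner_eval hornerC.
- move=> i; rewrite ltnS leq_eqVlt => /orP[/eqP->|/evX[p pE]].
    by exists 'X => x /=; rewrite map_polyX /horner_eval hornerX.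
  by exists p%:P => x /=; rewrite map_polyC /= pE /horner_eval hornerC.
Qed.

(** By noetherianity one of these polynomials is a combination of its predecessors, which all vanish
    at [x n]; but it does not vanish there. *)
Lemma no_polynomial_descent (L : fieldType) (I : finType) (x : nat -> I -> L)
    (D : nat -> finType) (a : forall n, D n -> L) (e : forall n, D n -> I -> nat) :
  (forall n, \sum_c a n c * \prod_i x n i ^+ e n c i != 0) ->
  (forall m n, (n < m)%N -> \sum_c a n c * \prod_i x m i ^+ e n c i = 0) ->
  False.
Proof.
move=> nz z; have [A [ev [nA evC evX]]] := noetherian_evaluation L #|I|.
pose y m j := if insub j is Some o then x m (@enum_val I I o) else 0.
have evx (i : I) : exists p, forall m, ev (y m) p = x m i.
  have [p pE] := evX (enum_rank i) (ltn_ord _); exists p => m.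
  by rewrite pE /y valK enum_rankK.
have [X XE] := choice evx; have [C CE] := choice evC.
pose f n := \sum_c C (a n c) * \prod_i X i ^+ e n c i.
have fE m n : ev (y m) (f n) = \sum_c a n c * \prod_i x m i ^+ e n c i.
  rewrite rmorph_sum; apply: eq_bigr => c _; rewrite rmorphM rmorph_prod CE.
  by congr (_ * _); apply: eq_bigr => i _; rewrite rmorphXn XE.
have [n [c]] := nA f; rewrite size_mkseq => /(congr1 (ev (y n))).
rewrite fE rmorph_sum => fn0; have := nz n; rewrite fn0 big1 ?eqxx // => i _.
by rewrite rmorphM nth_mkseq // fE z ?mulr0.
Qed.

End Hilbert.

(** * Linear algebra and growth *)

(** A free family of maximal length works: a vector outside its span would extend it. *)
Lemma finite_spanning (L : fieldType) (N : nat) (T : Type) (P : T -> Prop)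
    (v : T -> 'rV[L]_N) :
  exists n (s : 'I_n -> T), [/\ (n <= N)%N, forall j, P (s j) &
    forall t, P t -> (v t <= \matrix_j v (s j))%MS].
Proof.
pose Q n := `[< exists s : 'I_n -> T,
  (forall j, P (s j)) /\ row_free (\matrix_j v (s j)) >].
have Q0 : exists n, Q n.
  exists 0; apply/asboolP; exists (fun j : 'I_0 => False_rect T (notF (ltn_ord j))).
  split=> [[]//|]; rewrite /row_free eqn_leq rank_leq_row //.
have QN n : Q n -> (n <= N)%N.
  by move=> /asboolP[s [_ /eqP <-]]; apply: rank_leq_col.
have [n Qn maxn] := ex_maxnP Q0 QN; have nN := QN n Qn.
move/asboolP: Qn => [s [sP sfree]]; exists n, s; split=> // t tP.
apply: contrapT => /negP tM.
pose s' (j : 'I_n.+1) := if unlift ord0 j is Some i then s i else t.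
have: Q n.+1.
  apply/asboolP; exists s'; split.
    by move=> j; rewrite /s'; case: unlift => [i|].
  rewrite /row_free eqn_leq rank_leq_row /=.
  pose M := \matrix_j v (s j); rewrite -{1}(eqP sfree) -/M.
  have MM' : (M + v t <= \matrix_j v (s' j))%MS.
    rewrite addsmx_sub; apply/andP; split.
      apply/row_subP => j; rewrite rowK.
      have -> : v (s j) = row (lift ord0 j) (\matrix_j v (s' j)).
        by rewrite rowK /s' liftK.
      exact: row_sub.
    have -> : v t = row ord0 (\matrix_j v (s' j)) by rewrite rowK /s' unlift_none.
    exact: row_sub.
  apply: leq_trans (mxrankS MM'); apply: rank_ltmx.
  by rewrite ltmxE addsmxSl /= addsmx_sub submx_refl.
by move/maxn; rewrite ltnn.
Qed.

Lemma bernoulli_ge (R : realFieldType) (e : R) n : 0 <= e -> 1 + n%:R * e <= (1 + e) ^+ n.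
Proof.
move=> e0; elim: n => [|n IHn]; first by rewrite mul0r addr0.
rewrite exprS; apply: le_trans (ler_wpM2l (addr_ge0 ler01 e0) IHn).
have : 0 <= n%:R * e * e by rewrite !mulr_ge0 ?ler0n.
by rewrite -natr1; lra.
Qed.

Lemma ler_of_poly_growth (R : realType) (D : nat) (x r : R) : 0 <= r ->
  (forall n, x ^+ n <= n.+1%:R ^+ D * r ^+ n) -> x <= r.
Proof.
move=> r0 hx; rewrite leNgt; apply/negP => rx.
have [r_eq0|rN0] := eqVneq r 0.
  by have := hx 1; rewrite !expr1 r_eq0 mulr0 leNgt -{1}r_eq0 rx.
have rp : 0 < r by rewrite lt_def rN0.
pose q := x / r.
have [e e0 qE] : exists2 e, 0 < e & q = 1 + e.
  by exists (q - 1); rewrite ?subrKC // subr_gt0 ltr_pdivlMr // mul1r.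
have q0 : 0 <= q by rewrite qE addr_ge0 // ltW.
have bernoulli m : m%:R * e <= q ^+ m.
  by rewrite qE (le_trans _ (bernoulli_ge _ (ltW e0))) // lerDr.
have qn n : q ^+ n <= n.+1%:R ^+ D.
  by rewrite expr_div_n ler_pdivrMr ?exprn_gt0.
(* Compare at [n = m * D.+1]: from below, Bernoulli to the power [D.+1]; from above,
   [n.+1 <= m * D.+2]. Cancelling [m ^+ D] leaves a bound on [m]. *)
have key m : (0 < m)%N -> m%:R * e ^+ D.+1 <= D.+2%:R ^+ D.
  move=> m0; have mp : 0 < (m%:R : R) ^+ D by rewrite exprn_gt0 ?ltr0n.
  rewrite -(ler_pM2l mp) mulrA -exprSr -exprMn.
  have h1 : (m%:R * e) ^+ D.+1 <= q ^+ (m * D.+1).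
    rewrite exprM lerXn2r ?bernoulli ?nnegrE //; last exact: exprn_ge0.
    by rewrite mulr_ge0 ?ler0n // ltW.
  apply: le_trans h1 (le_trans (qn _) _).
  rewrite -exprMn -natrM lerXn2r ?nnegrE ?ler0n // ler_nat.
  by rewrite (mulnS m D.+1) -addn1 addnC leq_add2r.
pose M := Num.bound (D.+2%:R ^+ D / e ^+ D.+1).
have ep : 0 < e ^+ D.+1 by rewrite exprn_gt0.
have := key M.+1 isT; rewrite leNgt => /negP; apply.
rewrite -ltr_pdivrMr //; apply: lt_le_trans (archi_boundP _) _.
  by rewrite divr_ge0 ?exprn_ge0 ?ler0n // ltW.
by rewrite ler_nat.
Qed.

(** * Ranks under random contractions *)

Section Linear.
Variable K : fieldType.

(* A random [0/1] functional is nonzero at a given nonzero vector with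
   probability at least [1/2], over any field. *)
Lemma nonvanishing_half (X : finType) (T : eqType) (l : seq T) (u : T -> X -> K) :
  {in l, forall q, exists x, u q x != 0} ->
  exists A : {set X},
    (size l <= (count (fun q => (\sum_(x in A) u q x)%R != 0%R) l).*2)%N.
Proof.
move=> unz; apply: contrapT => /forallNP noA.
have card_nz q : q \in l ->
    (#|{set X}| <= #|[set A : {set X} | (\sum_(x in A) u q x)%R != 0%R]|.*2)%N.
  move=> /unz[x ux]; set NZ := [set A | _].
  (* Toggling [x] changes the sum by [u q x] up to sign, so [flip] injects the sets with zero sum
     into the others. *)
  pose flip (A : {set X}) := if x \in A then A :\ x else x |: A.
  have flipK : involutive flip.
    move=> A; rewrite /flip; have [xA|xA] := boolP (x \in A).
      by rewrite in_setD1 eqxx /= setD1K.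
    by rewrite in_setU1 eqxx /= setU1K.
  have sub : flip @: (~: NZ) \subset NZ.
    apply/subsetP => _ /imsetP[A + ->]; rewrite !inE negbK /flip.
    have [xA|xA] := boolP (x \in A).
      rewrite (big_setD1 x) //= addrC addr_eq0 => /eqP->.
      by rewrite oppr_eq0.
    by rewrite big_setU1 //= => /eqP->; rewrite addr0.
  rewrite -(cardsC NZ) -addnn leq_add2l.
  by rewrite -(card_imset _ (can_inj flipK)) subset_leq_card.
(* The assumed failure is summed over all [A]; exchanging the two sums contradicts [card_nz]. *)
have: (\sum_(A : {set X}) (count (fun q => (\sum_(x in A) u q x)%R != 0%R) l).*2
       < \sum_(A : {set X}) size l)%N.
  rewrite [ltnLHS](bigD1 set0) //= [ltnRHS](bigD1 set0) //= -addSn.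
  apply: leq_add; first by rewrite ltnNge; apply/negP/noA.
  by apply: leq_sum => A _; rewrite ltnW // ltnNge; apply/negP/noA.
rewrite ltnNge => /negP; apply; rewrite sum_nat_const mulnC.
under [leqRHS]eq_bigr do rewrite -sum1_count -muln2 big_distrl /=.
rewrite (eq_bigr (fun A : {set X} =>
  \sum_(q <- l) if (\sum_(x in A) u q x)%R != 0%R then 2 else 0))%N; last first.
  by move=> A _; rewrite big_mkcond; apply: eq_bigr => q _; case: ifP.
rewrite exchange_big /= -sum1_size big_distrl /= big_seq [leqRHS]big_seq.
apply: leq_sum => q /card_nz; rewrite mul1n; move/leq_trans; apply.
rewrite -big_mkcond sum_nat_const muln2 leq_double subset_leq_card //.
by apply/subsetP => A; rewrite inE.
Qed.

Section Chain.
Variables (T : eqType) (b m : nat) (M : T -> 'M[K]_(b, m)).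

(* [f] certifies that the row space of [M c] leaves the span of the later ones. *)
Fixpoint chain (l : seq (T * 'cV[K]_m)) : Prop :=
  if l is (c, f) :: l' then
    [/\ chain l', M c *m f != 0 & {in l', forall q, M q.1 *m f = 0}]
  else True.

Lemma chain_neq0 l : chain l -> {in l, forall q, M q.1 *m q.2 != 0}.
Proof.
elim: l => //= [[c f] l] IHl [/IHl lP cf _] q; rewrite inE.
by case/orP => [/eqP->//|/lP].
Qed.

(** Greedy choice: the row spaces chosen so far span too little to contain all rows of [G], so some
    [M c] leaves that span; a column of the cokernel matrix certifies it. *)
Lemma chain_exists r (G : 'M[K]_(r, m)) n p :
  (forall c, (\rank (M c) <= n)%N) ->
  (forall j, exists c, (row j G <= M c)%MS) -> (n * p < \rank G)%N ->
  exists l, size l = p /\ chain l.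
Proof.
move=> Mn GM pG; suff [l [S [lp cl _ _]]] : exists l (S : 'M[K]_m),
    [/\ size l = p, chain l, (\rank S <= n * p)%N &
      {in l, forall q, (M q.1 <= S)%MS}] by exists l.
elim: p pG => [|p IHp] pG; first by exists [::], 0; rewrite mxrank0.
have [|l [S [lp cl Sr lS]]] := IHp.
  by apply: leq_ltn_trans pG; rewrite leq_mul2l leqnSn orbT.
have [c cS] : exists c, ~ (M c <= S)%MS.
  apply: contrapT => /forallNP noc; move: pG; rewrite ltnNge => /negP; apply.
  apply: leq_trans (mxrankS (_ : (G <= S)%MS)) _; last first.
    by apply: leq_trans Sr _; rewrite leq_mul2l leqnSn orbT.
  apply/row_subP => j; have [c jc] := GM j.
  by apply: submx_trans jc _; apply: contrapT; apply: noc.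
have /matrix0Pn[i [j Mij]] : M c *m cokermx S != 0.
  by apply: contra_notN cS; rewrite submxE.
exists ((c, col j (cokermx S)) :: l), (M c + S)%MS; split.
- by rewrite /= lp.
- split=> //.
    by apply/matrix0Pn; exists i, 0; rewrite colE mulmxA -colE mxE.
  move=> q /lS; rewrite submxE => /eqP qS.
  by rewrite colE mulmxA qS mul0mx.
- rewrite mulnS; apply: leq_trans (leq_add (Mn c) Sr).
  exact: mxrank_adds_leqif.
- move=> q; rewrite inE => /orP[/eqP->|/lS qS]; first exact: addsmxSl.
  exact: submx_trans qS (addsmxSr _ _).
Qed.

(** Each counted [f] is nonzero on its own vector [phi *m M c] and kills those further down the
    list, so the counted vectors are independent. *)
Lemma chain_rank l r (G : 'M[K]_(r, m)) (phi : 'rV[K]_b) :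
  chain l -> (forall c, (phi *m M c <= G)%MS) ->
  (count (fun q => phi *m M q.1 *m q.2 != 0)%R l <= \rank G)%N.
Proof.
move=> cl phiG; suff [S [SG lS _]] : exists S : 'M[K]_m, [/\ (S <= G)%MS,
    (count (fun q => phi *m M q.1 *m q.2 != 0)%R l <= \rank S)%N &
    forall f : 'cV_m, {in l, forall q, M q.1 *m f = 0} -> S *m f = 0].
  exact: leq_trans lS (mxrankS SG).
elim: l cl => [_|[c f] l IHl /= [/IHl[S [SG lS Sf]] cf lf]].
  by exists 0; rewrite sub0mx mxrank0; split=> // f _; rewrite mul0mx.
have [phif|phif] := eqVneq (phi *m M c *m f) 0.
  exists S; split=> // g gl; apply: Sf => q ql; apply: gl.
  by rewrite inE ql orbT.
exists (phi *m M c + S)%MS; split.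
- by rewrite addsmx_sub phiG.
- apply: leq_ltn_trans lS _; apply: rank_ltmx.
  rewrite ltmxE addsmxSr /= addsmx_sub submx_refl andbT.
  apply: contra phif => /submxP[D ->].
  by rewrite -mulmxA Sf ?mulmx0.
- move=> g gl; have Sg : S *m g = 0.
    by apply: Sf => q ql; apply: gl; rewrite inE ql orbT.
  have cg : M c *m g = 0 by apply: (gl (c, f)); rewrite inE eqxx.
  apply/eqP; rewrite -submx0.
  have : ((phi *m M c + S)%MS *m g <= (phi *m M c) *m g + S *m g)%MS.
    by rewrite -addsmxMr.
  by rewrite Sg -mulmxA cg mulmx0 addsmx0 submx0.
Qed.

(** There is a chain of length [p.*2]. By [nonvanishing_half], contraction with the indicator of a
    suitable [A] keeps at least half of its vectors [M c *m f] nonzero, and each of these adds to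
    the rank. *)
Lemma contraction_rank r (G : 'M[K]_(r, m)) n p :
  (forall c, (\rank (M c) <= n)%N) ->
  (forall j, exists c, (row j G <= M c)%MS) -> (n * p.*2 < \rank G)%N ->
  exists A : {set 'I_b}, forall r' (G' : 'M[K]_(r', m)),
    (forall c, ((\row_x (x \in A)%B%:R) *m M c <= G')%MS) -> (p <= \rank G')%N.
Proof.
move=> Mn GM pG; have [l [lp cl]] := chain_exists Mn GM pG.
pose u (q : T * 'cV[K]_m) x := (M q.1 *m q.2) x 0.
have [q /(chain_neq0 cl)/matrix0Pn[x [y]]|A] := @nonvanishing_half _ _ l u.
  by rewrite ord1; exists x.
rewrite lp leq_double => pA; exists A => r' G' AG'; apply: leq_trans pA _.
apply: leq_trans (chain_rank cl AG'); apply: sub_count => q.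
apply: contraNN; rewrite -mulmxA => /eqP/matrixP/(_ 0 0); rewrite !mxE => e0.
rewrite -[X in _ == X]e0 big_mkcond; apply/eqP/eq_bigr => x _; rewrite mxE.
by case: (x \in A); rewrite ?mul1r ?mul0r.
Qed.
End Chain.
End Linear.

(** * Tensors with uniform legs *)

Lemma prod_deltaE (A : comNzRingType) (I : finType) (b : pred I) :
  \prod_i ((b i)%:R : A) = [forall i, b i]%:R.
Proof.
have [/forallP bT|/forallPn[i /negbTE bi]] := boolP [forall i, b i].
  by rewrite big1 // => i _; rewrite bT.
by rewrite (bigD1 i) //= bi mul0r.
Qed.

Section Spectrum.
Variables (R : realType) (K : fieldType) (k : nat).
Variable F : forall d : format k, tensor K d -> R.
Implicit Types (d e : format k) (X Y Z : finType).
Hypotheses (k_gt0 : (0 < k)%N) (hF : asymptotic_spectrum R K k F).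

Lemma spectrum_ge0 d (T : tensor K d) : 0 <= F T.
Proof. by case: hF => + _ _ _ _; apply. Qed.

Lemma spectrum_kronecker d e (S : tensor K d) (T : tensor K e) :
  F (kronecker S T) = F S * F T.
Proof. by case: hF => _ + _ _ _; apply. Qed.

Lemma spectrum_direct_sum d e (S : tensor K d) (T : tensor K e) :
  F (direct_sum S T) = F S + F T.
Proof. by case: hF => _ _ + _ _; apply. Qed.

Lemma spectrum_unit r : F (unit_tensor K k r) = r%:R.
Proof. by case: hF => _ _ _ + _; apply. Qed.

Lemma spectrum_restriction d e (S : tensor K d) (T : tensor K e) :
  restriction S T -> F S <= F T.
Proof. by case: hF => _ _ _ _; apply. Qed.

Lemma sum_multi_index_delta d (x : multi_index d) (f : multi_index d -> K) :
  \sum_(y : multi_index d) (\prod_i (y i == x i)%:R) * f y = f x.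
Proof.
rewrite (bigD1 x) //= big1 => [|i _]; last by rewrite eqxx.
rewrite mul1r big1 ?addr0 // => y yx.
rewrite prod_deltaE; case: forallP => [/= yxE|]; last by rewrite mul0r.
by case/eqP: yx; apply/ffunP => i; apply/eqP/yxE.
Qed.

Lemma spectrum_pullback d e (S : tensor K d) (T : tensor K e)
    (h : forall i, 'I_(d i) -> 'I_(e i)) :
  (forall x, S x = T [ffun i => h i (x i)]) -> F S <= F T.
Proof.
move=> ST; apply: spectrum_restriction.
exists (fun i => \matrix_(a, b) (b == h i a)%:R); apply/ffunP => x.
rewrite ffunE ST -[LHS]sum_multi_index_delta; apply: eq_bigr => y _.
by congr (_ * _); apply: eq_bigr => i _; rewrite mxE ffunE.
Qed.

(** [S + T] is the image of the direct sum under the folding map on every leg. *)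
Lemma spectrum_add d (S T : tensor K d) : F (S + T) <= F S + F T.
Proof.
rewrite -spectrum_direct_sum; apply: spectrum_restriction.
exists (fun i => row_mx 1%:M 1%:M); apply/ffunP => x; rewrite !ffunE.
pose A i := row_mx (1%:M : 'M[K]_(d i)) (1%:M : 'M[K]_(d i)).
pose w (y : multi_index (fun i => (d i + d i)%N)) := \prod_i A i (x i) (y i).
have inl (U : tensor K d) (g : forall i, 'I_(d i) -> 'I_(d i + d i)) :
    (forall i a, A i (x i) (g i a) = (a == x i)%:R) ->
    \sum_y w y * (\sum_(z : multi_index d | [forall i, y i == g i (z i)]) U z)
    = U x.
  move=> gA.
  pose G z : multi_index (fun i => (d i + d i)%N) := [ffun i => g i (z i)].
  under eq_bigr do rewrite mulr_sumr big_mkcond.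
  rewrite exchange_big -[RHS]sum_multi_index_delta; apply: eq_bigr => z _.
  rewrite -big_mkcond /= (big_pred1 (G z)) => [|y].
    by congr (_ * _); apply: eq_bigr => i _; rewrite ffunE gA.
  apply/forallP/eqP => [yE|-> i]; last by rewrite ffunE.
  by apply/ffunP => i; rewrite ffunE; apply/eqP/yE.
under eq_bigr do rewrite ffunE mulrDr; rewrite big_split /=.
congr (_ + _); symmetry.
  by apply: (inl S (fun i => lshift (d i))) => i a; rewrite row_mxEl mxE eq_sym.
by apply: (inl T (fun i => @rshift (d i) (d i))) => i a; rewrite row_mxEr mxE eq_sym.
Qed.

Lemma spectrum_zero d : F (0 : tensor K d) = 0.
Proof.
apply/eqP; rewrite eq_le spectrum_ge0 andbT -[leRHS](spectrum_unit 0).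
apply: spectrum_restriction; exists (fun=> 0); apply/ffunP => x.
by rewrite !ffunE big1 // => y; case: (y (Ordinal k_gt0)).
Qed.

(* Any tensor can be padded with zeros so that its [k] legs are indexed by a single
   finite type; this avoids dependent formats. *)
Definition legs (X : finType) := {ffun 'I_k -> X}.

Definition leg_code (X : finType) (x : legs X) : multi_index (fun _ : 'I_k => #|X|) :=
  [ffun i => enum_rank (x i)].

Definition leg_decode (X : finType) (x : multi_index (fun _ : 'I_k => #|X|)) : legs X :=
  [ffun i => enum_val (x i)].

Lemma leg_codeK X : cancel (@leg_code X) (@leg_decode X).
Proof. by move=> x; apply/ffunP => i; rewrite !ffunE enum_rankK. Qed.

Lemma leg_decodeK X : cancel (@leg_decode X) (@leg_code X).
Proof. by move=> x; apply/ffunP => i; rewrite !ffunE enum_valK. Qed.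

Definition spec (X : finType) (t : legs X -> K) : R :=
  F ([ffun x => t (leg_decode x)] : tensor K (fun _ : 'I_k => #|X|)).

Definition leg_apply (X Y : finType) (A : 'I_k -> X -> Y -> K) (t : legs Y -> K)
    (x : legs X) : K :=
  \sum_(y : legs Y) (\prod_i A i (x i) (y i)) * t y.

Lemma spec_ge0 X (t : legs X -> K) : 0 <= spec t.
Proof. exact: spectrum_ge0. Qed.

Lemma spec_app X Y (A : 'I_k -> X -> Y -> K) (t : legs Y -> K) :
  spec (leg_apply A t) <= spec t.
Proof.
apply: spectrum_restriction.
exists (fun i => \matrix_(a, b) A i (enum_val a) (enum_val b)).
apply/ffunP => x; rewrite !ffunE /leg_apply (reindex (@leg_decode Y)); last first.
  by exists (@leg_code Y) => y _; rewrite ?leg_codeK ?leg_decodeK.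
apply: eq_bigr => y _; rewrite ffunE; congr (_ * _).
by apply: eq_bigr => i _; rewrite mxE !ffunE.
Qed.

Lemma sum_legs_delta X (x : legs X) (f : legs X -> K) :
  \sum_(y : legs X) (\prod_i (y i == x i)%:R) * f y = f x.
Proof.
rewrite (bigD1 x) //= big1 => [|i _]; last by rewrite eqxx.
rewrite mul1r big1 ?addr0 // => y yx.
rewrite prod_deltaE; case: forallP => [/= yxE|]; last by rewrite mul0r.
by case/eqP: yx; apply/ffunP => i; apply/eqP/yxE.
Qed.

Lemma app_pullback X Y (h : 'I_k -> X -> Y) (t : legs Y -> K) x :
  leg_apply (fun i a b => (b == h i a)%:R) t x = t [ffun i => h i (x i)].
Proof.
rewrite -[RHS]sum_legs_delta; apply: eq_bigr => y _; congr (_ * _).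
by apply: eq_bigr => i _; rewrite ffunE.
Qed.

Lemma spec_pullback X Y (h : 'I_k -> X -> Y) (t : legs Y -> K) :
  spec (fun x => t [ffun i => h i (x i)]) <= spec t.
Proof.
have := spec_app (fun i a b => (b == h i a)%:R) t.
by congr (spec _ <= _); apply/funext => x; apply: app_pullback.
Qed.

Lemma app_comp X Y Z (A : 'I_k -> X -> Y -> K) (B : 'I_k -> Y -> Z -> K) t :
  leg_apply A (leg_apply B t) = leg_apply (fun i a c => \sum_b A i a b * B i b c) t.
Proof.
apply/funext => x; rewrite /leg_apply; under eq_bigr do rewrite mulr_sumr.
rewrite exchange_big; apply: eq_bigr => z _; rewrite bigA_distr_bigA mulr_suml.
by apply: eq_bigr => y _; rewrite big_split mulrA.
Qed.

Definition upd X (x : legs X) (i : 'I_k) (a : X) : legs X :=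
  [ffun l => if l == i then a else x l].

Definition leg_act X (i : 'I_k) (M : X -> X -> K) (t : legs X -> K) (x : legs X) :=
  \sum_a M (x i) a * t (upd x i a).

Lemma app_act X i (M : X -> X -> K) t :
  leg_apply (fun l a b => if l == i then M a b else (b == a)%:R) t = leg_act i M t.
Proof.
apply/funext => x; rewrite /leg_apply /leg_act.
rewrite (partition_big (fun y : legs X => y i) predT) //=; apply: eq_bigr => a _.
rewrite (bigD1 (upd x i a)) ?ffunE ?eqxx //= [X in _ + X]big1 ?addr0.
  rewrite (bigD1 i) //= eqxx ffunE eqxx big1 ?mulr1 // => l li.
  by rewrite (negbTE li) ffunE (negbTE li) eqxx.
move=> y /andP[/eqP yi yx].
have [/forallP yE|/forallPn[l]] := boolP [forall l, (l == i) || (y l == x l)].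
  case/eqP: yx; apply/ffunP => l; rewrite ffunE; have := yE l.
  by case: eqP => [->|_ /eqP].
rewrite negb_or => /andP[li yl].
by rewrite (bigD1 l) //= (negbTE li) (negbTE yl) !mul0r.
Qed.

Lemma spec_act X i (M : X -> X -> K) t : spec (leg_act i M t) <= spec t.
Proof. by rewrite -app_act; apply: spec_app. Qed.

Lemma spec_add X (s t : legs X -> K) :
  spec (fun x => s x + t x) <= spec s + spec t.
Proof.
rewrite (le_trans _ (spectrum_add _ _)) // le_eqVlt; apply/orP; left; apply/eqP.
by congr F; apply/ffunP => x; rewrite !ffunE.
Qed.

Lemma spec_scale X c (t : legs X -> K) : spec (fun x => c * t x) <= spec t.
Proof.
have := spec_act (Ordinal k_gt0) (fun a b => c * (b == a)%:R) t.
congr (spec _ <= _); apply/funext => x.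
rewrite /leg_act (bigD1 (x (Ordinal k_gt0))) //= eqxx mulr1.
rewrite big1 ?addr0; first congr (_ * t _).
  by apply/ffunP => l; rewrite ffunE; case: eqP => [->|].
by move=> a /negbTE->; rewrite mulr0 mul0r.
Qed.

Lemma spec_sum X n (c : 'I_n -> K) (t : 'I_n -> legs X -> K) :
  spec (fun x => \sum_j c j * t j x) <= \sum_j spec (t j).
Proof.
elim: n c t => [|n IHn] c t.
  rewrite big_ord0 -(spectrum_zero (fun=> #|X|)) le_eqVlt; apply/orP; left.
  by apply/eqP; congr F; apply/ffunP => x; rewrite !ffunE big_ord0.
rewrite big_ord_recl; under [X in spec X]funext do rewrite big_ord_recl.
apply: le_trans (spec_add _ _) _; apply: lerD; first exact: spec_scale.
exact: IHn.
Qed.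

Lemma spec_mul X Y (s : legs X -> K) (t : legs Y -> K) :
  spec (fun z : legs (X * Y)%type => s [ffun i => (z i).1] * t [ffun i => (z i).2])
  = spec s * spec t.
Proof.
rewrite -spectrum_kronecker; apply/eqP; rewrite eq_le; apply/andP; split.
  pose h (i : 'I_k) (a : 'I_#|{: X * Y}|) : 'I_(#|X| * #|Y|) :=
    mxtens_index (enum_rank (enum_val a).1, enum_rank (enum_val a).2).
  apply: (spectrum_pullback (h := h)) => x; rewrite !ffunE.
  congr (s _ * t _); apply/ffunP => i; rewrite !ffunE mxtens_indexK.
    by rewrite enum_rankK.
  by rewrite enum_rankK.
pose h (i : 'I_k) (a : 'I_(#|X| * #|Y|)) : 'I_#|{: X * Y}| :=
  enum_rank (enum_val (mxtens_unindex a).1, enum_val (mxtens_unindex a).2).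
apply: (spectrum_pullback (h := h)) => x; rewrite !ffunE.
by congr (s _ * t _); apply/ffunP => i; rewrite !ffunE enum_rankK.
Qed.

Lemma spec_unit : spec (fun _ : legs unit => 1) = 1.
Proof.
rewrite -[RHS](spectrum_unit 1); apply/eqP; rewrite eq_le; apply/andP.
have unitE (x : multi_index (fun _ : 'I_k => 1%N)) : unit_tensor K k 1 x = 1.
  by rewrite ffunE big_ord1 big1 // => i _; rewrite ord1 eqxx.
split.
  by apply: (spectrum_pullback (h := fun _ _ => ord0)) => x; rewrite ffunE unitE.
apply: (spectrum_pullback (h := fun _ _ => enum_rank tt)) => x.
by rewrite unitE ffunE.
Qed.

(** The [n]-th Kronecker power, each leg indexed by [n]-tuples. *)
Definition tpow X n (t : legs X -> K) (x : legs {ffun 'I_n -> X}) : K :=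
  \prod_(m < n) t [ffun i => x i m].

Lemma spec_tpow X n (t : legs X -> K) : spec (tpow (n := n) t) = spec t ^+ n.
Proof.
elim: n => [|n IHn].
  rewrite expr0 -spec_unit; apply/eqP; rewrite eq_le; apply/andP; split.
    have := spec_pullback (fun _ (_ : {ffun 'I_0 -> X}) => tt) (fun=> 1).
    by congr (spec _ <= _); apply/funext => x; rewrite /tpow big_ord0.
  have := spec_pullback (fun _ (_ : unit) => ffun0 (card_ord 0))
    (tpow (n := 0) t).
  by congr (spec _ <= _); apply/funext => x; rewrite /tpow big_ord0.
rewrite exprS -IHn -spec_mul; apply/eqP; rewrite eq_le; apply/andP; split.
  have := spec_pullback (fun _ (y : {ffun 'I_n.+1 -> X}) =>
    (y ord0, [ffun m : 'I_n => y (lift ord0 m)]))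
    (fun z : legs (X * {ffun 'I_n -> X})%type =>
      t [ffun i => (z i).1] * tpow t [ffun i => (z i).2]).
  congr (spec _ <= _); apply/funext => x; rewrite /tpow big_ord_recl.
  congr (t _ * _); first by apply/ffunP => i; rewrite !ffunE.
  by apply: eq_bigr => m _; congr t; apply/ffunP => i; rewrite !ffunE.
have := spec_pullback (fun _ (y : X * {ffun 'I_n -> X}) =>
  [ffun m : 'I_n.+1 => if unlift ord0 m is Some j then y.2 j else y.1])
  (tpow (n := n.+1) t).
congr (spec _ <= _); apply/funext => x; rewrite /tpow big_ord_recl.
congr (t _ * _); first by apply/ffunP => i; rewrite !ffunE unlift_none.
by apply: eq_bigr => m _; congr t; apply/ffunP => i; rewrite !ffunE liftK.
Qed.
End Spectrum.

(** * Values in a fixed format *)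

Section Descent.
Variables (R : realType) (K : fieldType) (k : nat).
Variable F : forall d : format k, tensor K d -> R.
Hypotheses (k_gt0 : (0 < k)%N) (hF : asymptotic_spectrum R K k F).
Local Notation spec := (spec F).

(** Exponents go up to [n] in each entry separately: all entries of the [n]-th power are among these
    monomials, and their number [n.+1 ^ #|legs k X|] is polynomial in [n]. *)
Definition monomials (X : finType) n (t : legs k X -> K) :
    'rV[K]_#|{ffun legs k X -> 'I_n.+1}| :=
  \row_c \prod_y t y ^+ (enum_val c : {ffun legs k X -> 'I_n.+1}) y.

(** The exponent of [t y] counts the positions [m] at which [x] reads [y], whatever [t] is. *)
Lemma tpow_monomials (X : finType) n (x : legs k {ffun 'I_n -> X}) :
  exists c, forall t, tpow t x = @monomials X n t 0 c.
Proof.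
pose g m : legs k X := [ffun i => x i m].
pose c : {ffun legs k X -> 'I_n.+1} := [ffun y => inord #|[pred m | g m == y]|].
exists (enum_rank c) => t; rewrite mxE enum_rankK /tpow.
rewrite (partition_big g predT) //=; apply: eq_bigr => y _.
rewrite ffunE inordK.
  rewrite -prodr_const; apply: eq_big => [m|m /eqP <-//].
  by rewrite inE.
by rewrite ltnS (leq_trans (max_card _)) ?card_ord.
Qed.

(* If all polynomials vanishing on [P] vanish at [t0], then [tpow n t0] is a
   combination of at most [(n+1)^D] powers [tpow n t] with [t] in [P]; as this
   count is subexponential, taking [n]-th roots gives the bound. *)
Lemma spec_zariski_closed (X : finType) (P : (legs k X -> K) -> Prop) (r : R) t0 :
  0 <= r -> (forall t, P t -> spec t <= r) -> r < spec t0 ->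
  exists n (a : 'I_#|{ffun legs k X -> 'I_n.+1}| -> K),
    (forall t, P t -> \sum_c a c * monomials n t 0 c = 0) /\
    \sum_c a c * monomials n t0 0 c != 0.
Proof.
move=> r0 Pr; rewrite ltNge => /negP rt0; apply: contrapT => noa; apply: rt0.
apply: (@ler_of_poly_growth _ #|legs k X|) => // n.
have [m [s [mN sP sspan]]] := finite_spanning P (@monomials X n).
pose M := \matrix_j monomials n (s j).
have t0M : (monomials n t0 <= M)%MS.
  apply: contrapT => t0M; apply: noa; exists n.
  (* Columns of [cokermx M] are coefficient vectors of polynomials vanishing on the spanning family,
     hence on all of [P]. *)
  have {t0M}: monomials n t0 *m cokermx M != 0.
    by apply: contra_notN t0M; rewrite submxE.
  case/rV0Pn => j Mj; exists (fun c => cokermx M c j); split=> [t /sspan|].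
    rewrite submxE => /eqP/rowP/(_ j); rewrite !mxE => tj.
    by rewrite -[RHS]tj; apply: eq_bigr => c _; rewrite mulrC.
  by move: Mj; rewrite mxE; under eq_bigr do rewrite mulrC.
have [u uE] := submxP t0M.
have t0E : tpow (n := n) t0 = fun x => \sum_j u 0 j * tpow (s j) x.
  apply/funext => x; have [c cE] := tpow_monomials x.
  rewrite cE uE mxE; apply: eq_bigr => j _.
  by rewrite cE mxE.
rewrite -(spec_tpow hF) t0E (le_trans (spec_sum k_gt0 hF _ _)) //.
have sumr : \sum_j spec (tpow (n := n) (s j)) <= m%:R * r ^+ n.
  rewrite -[X in X%:R]card_ord mulr_natl -sumr_const; apply: ler_sum => j _.
  by rewrite (spec_tpow hF) lerXn2r ?nnegrE ?(spec_ge0 hF) // Pr.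
apply: le_trans sumr (ler_wpM2r (exprn_ge0 _ r0) _).
by rewrite -natrX ler_nat (leq_trans mN) // card_ffun card_ord.
Qed.

(** The terms after [t n] have value at most [spec (t n.+1)], so some polynomial vanishes on all of
    them but not at [t n]. For all [n] at once this contradicts Hilbert's theorem. *)
Lemma spec_no_descent (X : finType) (t : nat -> legs k X -> K) :
  ~ (forall n, spec (t n.+1) < spec (t n)).
Proof.
move=> dec.
have mono m n : (m <= n)%N -> spec (t n) <= spec (t m).
  elim: n => [|n IHn]; first by rewrite leqn0 => /eqP->.
  by rewrite leq_eqVlt => /orP[/eqP->//|/IHn]; apply: le_trans; apply: ltW.
have sep n : exists d : {N & 'I_#|{ffun legs k X -> 'I_N.+1}| -> K},
   (forall m, (n < m)%N -> \sum_c projT2 d c * monomials (projT1 d) (t m) 0 c = 0) /\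
   \sum_c projT2 d c * monomials (projT1 d) (t n) 0 c != 0.
  have [] := @spec_zariski_closed _ (fun s => exists2 m, (n < m)%N & s = t m) _
    (t n) (spec_ge0 hF (t n.+1)) _ (dec n).
    by move=> _ [m nm ->]; apply: mono.
  move=> N [a [az anz]]; exists (existT _ N a); split=> //= m nm.
  by apply: az; exists m.
have [d dP] := choice sep.
apply: (@no_polynomial_descent K (legs k X) t _ (fun n => projT2 (d n))
  (fun n c y => (enum_val c : {ffun legs k X -> 'I_(projT1 (d n)).+1}) y)).
- move=> n; have [_] := dP n; congr (_ != 0); apply: eq_bigr => c _.
  by rewrite mxE.
- move=> m n mn; have [/(_ _ mn) + _] := dP n => n0.
  rewrite -[RHS]n0; apply: eq_bigr => c _.
  by rewrite mxE.
Qed.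

End Descent.

(** * Flattening ranks and EPR pairs *)

Section Flattening.
Variables (R : realType) (K : fieldType) (k : nat).
Variable F : forall d : format k, tensor K d -> R.
Hypotheses (hF : asymptotic_spectrum R K k F).
Local Notation spec := (spec F).
Implicit Types (X : finType) (i j : 'I_k).

(** Legs outside [S] carry all-ones vectors, so [t] is in effect a tensor on the legs in [S]; thus
    [k] stays fixed when legs are merged. *)
Definition depends X (S : {set 'I_k}) (t : legs k X -> K) :=
  forall x y : legs k X, {in S, forall l, x l = y l} -> t x = t y.

Definition epr i j X (x : legs k X) : K := (x i == x j)%:R.

(* The transpose of the flattening of [t] along leg [i]. *)
Definition flat m i (t : legs k 'I_m -> K) : 'M[K]_(#|legs k 'I_m|, m) :=
  \matrix_(c, a) t (upd (enum_val c) i a).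

(** For distinct [i] and [j], every row of [flat i t] is a row of some slice, as [contraction_rank]
    requires. *)
Definition slice m i j (t : legs k 'I_m -> K) (c : legs k 'I_m) : 'M[K]_m :=
  \matrix_(b, a) t (upd (upd c i a) j b).

Lemma rank_flat_dep1 m i (t : legs k 'I_m -> K) :
  depends [set i] t -> (\rank (flat i t) <= 1)%N.
Proof.
move=> ti; have -> : flat i t = const_mx 1 *m (\row_a t [ffun=> a]).
  apply/matrixP => c a; rewrite mxE [RHS]mxE big_ord1 !mxE mul1r.
  by apply: ti => l; rewrite inE => /eqP->; rewrite !ffunE eqxx.
exact: mulmx_max_rank.
Qed.

Lemma rank_flat_indep m i (S : {set 'I_k}) (t : legs k 'I_m -> K) :
  i \notin S -> depends S t -> (\rank (flat i t) <= 1)%N.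
Proof.
move=> iS tS; have -> : flat i t = (\col_c t (enum_val c)) *m const_mx 1.
  apply/matrixP => c a; rewrite mxE [RHS]mxE big_ord1 !mxE mulr1.
  apply: tS => l lS; rewrite ffunE; case: eqP => // li.
  by rewrite -li lS in iS.
exact: mulmx_max_rank.
Qed.

(** Freezing the other legs at [c] leaves the slice. Invertible maps on legs [i] and [j] bring it to
    [pid_mx], whose corner of size [n] is the EPR pair. *)
Lemma epr_le_slice m i j n (t : legs k 'I_m -> K) c :
  i != j -> (n <= \rank (slice i j t c))%N ->
  spec (epr i j (X := 'I_n)) <= spec t.
Proof.
move=> ij nr; set M := slice i j t c in nr.
have nm : (n <= m)%N := leq_trans nr (rank_leq_row M).
pose P := invmx (col_ebase M); pose Q := invmx (row_ebase M).
have PMQ : P *m M *m Q = pid_mx (\rank M).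
  rewrite -{1}(mulmx_ebase M) !mulmxA mulVmx ?col_ebase_unit // mul1mx.
  by rewrite mulmxK ?row_ebase_unit.
pose t1 := leg_act j (fun b b' => P b b') (leg_act i (fun a a' => Q a' a) t).
have t1t : spec t1 <= spec t := le_trans (spec_act hF _ _ _) (spec_act hF _ _ _).
apply: le_trans t1t; pose w := widen_ord nm.
have := spec_pullback hF
  (fun l (a : 'I_n) => if (l == i) || (l == j) then w a else c l) t1.
congr (spec _ <= _); apply/funext => x; set y := [ffun l => _].
have yj : y j = w (x j) by rewrite ffunE eqxx orbT.
have yi : y i = w (x i) by rewrite ffunE eqxx.
transitivity ((P *m M *m Q) (w (x j)) (w (x i))).
  rewrite -mulmxA mxE /t1 /leg_act yj; apply: eq_bigr => b _; congr (_ * _).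
  rewrite mxE; apply: eq_bigr => a _; rewrite ffunE (negbTE ij) yi mulrC mxE.
  congr (t _ * _); apply/ffunP => l; rewrite !ffunE; have [->|li] := eqVneq l i.
    by rewrite (negbTE ij).
  by case: (eqVneq l j) => //= lj; rewrite ?(negbTE li).
rewrite PMQ mxE /epr /= (leq_trans (ltn_ord _) nr) andbT.
by rewrite eq_sym -val_eqE.
Qed.

(** Induction on the number of legs acted upon, one leg at a time. *)
Lemma app_act_all X (Q : 'I_k -> X -> X -> K) (t : legs k X -> K) :
  (forall i, leg_act i (Q i) t = t) -> leg_apply Q t = t.
Proof.
move=> Qt.
have part n : (n <= k)%N ->
    leg_apply (fun l a b => if (l < n)%N then Q l a b else (b == a)%:R) t = t.
  elim: n => [_|n IHn nk].
    apply/funext => x; rewrite -[RHS](sum_legs_delta x); apply: eq_bigr => y _.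
    by congr (_ * _); apply: eq_bigr => i _.
  pose i := Ordinal nk; rewrite -[RHS](Qt i) -app_act.
  rewrite -[X in _ = leg_apply _ X](IHn (ltnW nk)) app_comp.
  congr (leg_apply _ t); apply/funext => l; apply/funext => a; apply/funext => b.
  have [->|li] := eqVneq l i.
    rewrite /= ltnn ltnSn (bigD1 b) //= eqxx mulr1 big1 ?addr0 // => c cb.
    by rewrite eq_sym (negbTE cb) mulr0.
  rewrite (bigD1 a) //= eqxx mul1r big1 ?addr0 => [|c /negbTE->]; last first.
    by rewrite mul0r.
  by rewrite ltnS leq_eqVlt (_ : (l == n :> nat) = false) // -(negbTE li).
rewrite -[RHS](part k (leqnn k)); congr (leg_apply _ t); apply/funext => l.
by rewrite ltn_ord.
Qed.

(** Leg [i] lives in the row space of [flat i t]. [G] passes to coordinates in a basis of it, padded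
    with zeros to [N], and [U] passes back, so [t] and [t'] restrict to each other. *)
Lemma spec_compress m N (t : legs k 'I_m -> K) :
  (forall i, (\rank (flat i t) <= N)%N) ->
  exists t' : legs k 'I_N -> K, spec t' = spec t.
Proof.
move=> rN; pose rb i := row_base (flat i t).
pose G i : 'M_(m, N) := pinvmx (rb i) *m pid_mx (\rank (flat i t)).
pose U i : 'M_(N, m) := pid_mx (\rank (flat i t)) *m rb i.
have AGU i : flat i t *m (G i *m U i) = flat i t.
  have rbGU : rb i *m (G i *m U i) = rb i.
    rewrite mulmxA [rb i *m G i]mulmxA mulmxVp ?row_base_free // mul1mx.
    by rewrite mulmxA pid_mx_id // pid_mx_1 mul1mx.
  by rewrite -{1}(mulmx_base (flat i t)) -mulmxA rbGU mulmx_base.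
pose t' := leg_apply (fun i a x => G i x a) t; exists t'.
apply/eqP; rewrite eq_le (spec_app hF) /=.
have {1}<- : leg_apply (fun i x a => U i a x) t' = t; last by apply: (spec_app hF).
rewrite /t' app_comp.
apply: (app_act_all (Q := fun i x y => \sum_b U i b x * G i y b)) => i.
apply/funext => x; rewrite /leg_act.
have /matrixP/(_ (enum_rank x) (x i)) := AGU i; rewrite mxE [X in _ = X]mxE enum_rankK.
have -> : upd x i (x i) = x by apply/ffunP => l; rewrite ffunE; case: eqP => [->|].
move=> <-; apply: eq_bigr => a _; rewrite !mxE enum_rankK mulrC; congr (_ * _).
by apply: eq_bigr => b _; rewrite mulrC.
Qed.

(** Induction on [J]. For [j] in [J], either some slice has rank at least [n j] and yields an EPR
    pair, or all slices have small rank and a 0/1 contraction of leg [j] keeps the flattening rank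
    large with one leg fewer. *)
Lemma rank_flat_epr i (n : 'I_k -> nat) (J : {set 'I_k}) : i \notin J ->
  exists N, forall m (t : legs k 'I_m -> K), depends (i |: J) t ->
    (N < \rank (flat i t))%N ->
    exists2 j, j \in J & spec (epr i j (X := 'I_(n j))) <= spec t.
Proof.
have [p] := ubnP #|J|; elim: p J => // p IHp J Jp iJ.
have [->|[j jJ]] := set_0Vmem J.
  exists 1 => m t; rewrite setU0 => /rank_flat_dep1.
  by rewrite leqNgt => /negP.
have ij : i != j by apply: contraNneq iJ => ->.
have [||N hN] := IHp (J :\ j).
- by rewrite (leq_trans _ (Jp : (#|J| <= p)%N)) // [leqRHS](cardsD1 j) jJ.
- by rewrite !inE negb_and iJ orbT.
(* The bound of [contraction_rank] with [p = N.+1], so that the contracted flattening has rank above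
   [N]. *)
exists (n j * N.+1.*2)%N => m t tJ rt.
have [/existsP[c cn]|/existsPn small] :=
  boolP [exists c, (n j <= \rank (slice i j t c))%N].
  by exists j => //; apply: epr_le_slice cn.
have [c|c|A AG] := @contraction_rank K _ _ _ (slice i j t) _ (flat i t) _ N.+1 _ _ rt.
- by apply: ltnW; rewrite ltnNge.
- exists (enum_val c).
  have -> : row c (flat i t) = row (enum_val c j) (slice i j t (enum_val c)).
    apply/rowP => a; rewrite !mxE; congr t; apply/ffunP => l; rewrite !ffunE.
    by have [->|//] := eqVneq l j; rewrite eq_sym (negbTE ij).
  exact: row_sub.
pose t' := leg_act j (fun _ b => (b \in A)%:R) t.
have [||l lJ lt'] := hN m t'.
- move=> x y xy; apply: eq_bigr => b _; congr (_ * _); apply: tJ => l lJ.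
  rewrite !ffunE; case: eqP => // /eqP lj; apply: xy.
  by move: lJ; rewrite !inE lj.
- apply: AG => c.
  have -> : \row_x (x \in A)%:R *m slice i j t c = row (enum_rank c) (flat i t').
    apply/rowP => a; rewrite !mxE enum_rankK /t' /leg_act; apply: eq_bigr => b _.
    by rewrite !mxE.
  exact: row_sub.
exists l; first by move: lJ; rewrite inE => /andP[].
exact: le_trans lt' (spec_act hF _ _ _).
Qed.

End Flattening.

(** * Merging legs *)

Section Merging.
Variables (R : realType) (K : fieldType) (k : nat).
Variable F : forall d : format k, tensor K d -> R.
Hypotheses (k_gt0 : (0 < k)%N) (hF : asymptotic_spectrum R K k F).
Local Notation spec := (spec F).
Implicit Types (X Y : finType) (i j : 'I_k).

Lemma spec_epr_le i j X Y (h : X -> Y) : injective h ->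
  spec (epr K i j (X := X)) <= spec (epr K i j (X := Y)).
Proof.
move=> h_inj; have := spec_pullback hF (fun _ => h) (epr K i j (X := Y)).
congr (spec _ <= _); apply/funext => x.
by rewrite /epr !ffunE (inj_eq h_inj).
Qed.

Lemma spec_epr_ge1 i j X (x0 : X) : 1 <= spec (epr K i j (X := X)).
Proof.
have := spec_pullback hF (fun _ (_ : unit) => x0) (epr K i j (X := X)).
rewrite -(spec_unit hF); congr (spec _ <= _); apply/funext => x.
by rewrite /epr !ffunE eqxx.
Qed.

(** [X] is inhabited because the empty EPR pair has value 0. *)
Definition mergeable i j := forall X, X -> spec (epr K i j (X := X)) = 1.

(** Some EPR pair has value above 1, its powers have unbounded values, and a Kronecker power of an
    EPR pair is again an EPR pair. *)
Lemma epr_unbounded i j : ~ mergeable i j ->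
  forall B, exists n, B < spec (epr K i j (X := 'I_n)).
Proof.
move=> nm B; have [X [x0 gN1]] : exists X (x0 : X), spec (epr K i j (X := X)) != 1.
  apply: contrapT => noX; apply: nm => X x0; apply: contrapT => gN1.
  by apply: noX; exists X, x0; apply/eqP.
set g := spec _ in gN1; pose e := g - 1.
have e0 : 0 < e by rewrite subr_gt0 lt_def gN1 spec_epr_ge1.
pose p := Num.bound (`|B| / e).
have Bp : B < g ^+ p.
  have gE : g = 1 + e by rewrite addrC subrK.
  rewrite gE (lt_le_trans _ (bernoulli_ge _ (ltW e0))) //.
  have : `|B| / e < p%:R by rewrite archi_boundP // divr_ge0 // ltW.
  by rewrite ltr_pdivrMr //; have := ler_norm B; lra.
exists #|{ffun 'I_p -> X}|; apply: lt_le_trans Bp _.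
apply: le_trans (spec_epr_le i j (@enum_rank_inj {ffun 'I_p -> X})).
rewrite -(spec_tpow hF) le_eqVlt; apply/orP; left; apply/eqP.
congr (spec _); apply/funext => x; rewrite /tpow /epr.
under eq_bigr do rewrite !ffunE.
rewrite prod_deltaE; congr (nat_of_bool _)%:R.
apply/forallP/eqP => [xE|-> //]; apply/ffunP => m; exact/eqP/xE.
Qed.

(* With an EPR pair between legs [i] and [j] leg [i] can be teleported to [j],
   and back. *)
Lemma merge_legs i j X (x0 : X) (t : legs k X -> K) :
  i != j -> mergeable i j ->
  exists t' : legs k (X * X)%type -> K, spec t' = spec t /\
    forall S : {set 'I_k}, j \in S -> depends S t -> depends (S :\ i) t'.
Proof.
move=> ij mij; have ji : j != i by rewrite eq_sym.
(* Leg [j] carries its own index and that of leg [i]; leg [i] becomes constant. *)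
pose t' (z : legs k (X * X)%type) :=
  t [ffun l => if l == i then (z j).2 else (z l).1].
exists t'; split; last first.
  move=> S jS tS z w zw; apply: tS => l lS; rewrite !ffunE.
  by case: eqP => [_|/eqP li]; rewrite zw // !inE ?ji ?li.
apply/eqP; rewrite eq_le; apply/andP; split.
  have := spec_mul hF t (epr K i j (X := X)); rewrite (mij X x0) mulr1 => <-.
  (* Leg [i] contracts its index against its half of the EPR pair, which moves the index to the half
     held by leg [j]. *)
  have := spec_act hF i (fun _ b : X * X => (b.1 == b.2)%:R)
    (fun z : legs k (X * X)%type =>
       t [ffun l => (z l).1] * epr K i j [ffun l => (z l).2]).
  congr (spec _ <= _); apply/funext => z; rewrite /leg_act.
  rewrite (bigD1 ((z j).2, (z j).2)) //= eqxx mul1r big1 ?addr0.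
    rewrite /epr !ffunE !eqxx (negbTE ji) eqxx mulr1; congr t.
    by apply/ffunP => l; rewrite !ffunE; case: eqP.
  move=> [b1 b2] /= bz; rewrite /epr !ffunE eqxx (negbTE ji) /=.
  have [b12|] := eqVneq b1 b2; last by rewrite mul0r.
  have [b2z|] := eqVneq b2 _; last by rewrite !mulr0.
  by case/eqP: bz; rewrite b12 b2z.
have := spec_mul hF t' (epr K i j (X := X)); rewrite (mij X x0) mulr1 => <-.
set s := (X in _ <= spec X).
(* Back again: leg [j] keeps its own index and contracts the transported one against its half of a
   new pair, so that it reappears on leg [i]. *)
pose q := leg_act j (fun a b : (X * X) * X => ((b.1.1 == a.1.1) && (b.1.2 == b.2))%:R) s.
apply: le_trans (spec_act hF _ _ _ : spec q <= _).
have := spec_pullback hF (fun _ (a : X) => ((a, a), a)) q.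
congr (spec _ <= _); apply/funext => x; rewrite /q /leg_act.
rewrite (bigD1 ((x j, x i), x i)) //= !ffunE !eqxx mul1r big1 ?addr0.
  rewrite /s /epr /t' !ffunE eqxx (negbTE ij) /= eqxx mulr1; congr t.
  apply/ffunP => l; rewrite !ffunE; have [->//|li] := eqVneq l i.
  by have [->|lj] := eqVneq l j.
move=> [[b1 b2] b3] /= bx; rewrite /s /epr !ffunE /= (negbTE ij) eqxx /=.
have [b1x|] := eqVneq b1 (x j); last by rewrite mul0r.
have [b23|] := eqVneq b2 b3; last by rewrite mul0r.
have [b3x|] := eqVneq (x i) b3; last by rewrite !mulr0.
by case/eqP: bx; rewrite b1x b23 b3x.
Qed.

(** Mergeable pairs among the remaining legs are merged as long as there are any; each merge removes
    a leg, and [epr_unbounded] applies to the pairs left at the end. *)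
Lemma live_legs : exists L : {set 'I_k},
  {in L &, forall i j, i != j -> forall B, exists n, B < spec (epr K i j (X := 'I_n))} /\
  forall X (x0 : X) (t : legs k X -> K),
    exists m (t' : legs k 'I_m -> K), spec t' = spec t /\ depends L t'.
Proof.
pose reducible S := forall X (x0 : X) (t : legs k X -> K),
  exists Y (y0 : Y) (t' : legs k Y -> K), spec t' = spec t /\ depends S t'.
suff [L [Lu Lr]] : exists L : {set 'I_k}, {in L &, forall i j, i != j ->
    forall B, exists n, B < spec (epr K i j (X := 'I_n))} /\ reducible L.
  exists L; split=> // X x0 t; have [Y [_ [t' [<- t'L]]]] := Lr X x0 t.
  exists #|Y|, (fun x => t' [ffun l => enum_val (x l)]); split.
    apply/eqP; rewrite eq_le (spec_pullback hF (fun _ => enum_val)) /=.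
    have := spec_pullback hF (fun _ => @enum_rank Y)
      (fun x => t' [ffun l => enum_val (x l)]).
    congr (spec _ <= _); apply/funext => x; congr t'.
    by apply/ffunP => l; rewrite !ffunE enum_rankK.
  by move=> x y xy; apply: t'L => l lL; rewrite !ffunE xy.
have : reducible [set: 'I_k].
  move=> X x0 t; exists X, x0, t; split=> // x y xy.
  by congr t; apply/ffunP => l; apply: xy.
have [p] := ubnP #|[set: 'I_k]|; elim: p [set: 'I_k] => // p IHp S Sp Sr.
have [Su|] := pselect {in S &, forall i j, i != j ->
    forall B, exists n, B < spec (epr K i j (X := 'I_n))}; first by exists S.
move=> nSu; have [i [j [iS jS ij mij]]] : exists i j,
    [/\ i \in S, j \in S, i != j & mergeable i j].
  apply: contrapT => nomerge; apply: nSu => i j iS jS ij.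
  by apply: epr_unbounded => mij; apply: nomerge; exists i, j.
apply: (IHp (S :\ i)).
  by rewrite (leq_trans _ (Sp : (#|S| <= p)%N)) // [leqRHS](cardsD1 i) iS.
move=> X x0 t; have [Y [y0 [t' [<- t'S]]]] := Sr X x0 t.
have [t'' [<- t''S]] := merge_legs y0 t' ij mij.
by exists (Y * Y)%type, (y0, y0), t''; split=> //; apply: t''S.
Qed.

(** For a leg [i] in [L], flattening rank above [N i] would force an EPR pair of value above [r]
    below [t]. *)
Lemma spec_le_bounded_size (r : R) : exists N, forall X (x0 : X) (t : legs k X -> K),
  spec t <= r -> exists t' : legs k 'I_N -> K, spec t' = spec t.
Proof.
have [L [Lu Lr]] := live_legs.
have [n nP] : exists n : 'I_k -> 'I_k -> nat, forall i j, i \in L -> j \in L ->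
    i != j -> r < spec (epr K i j (X := 'I_(n i j))).
  have ex i j : exists n, i \in L -> j \in L -> i != j ->
      r < spec (epr K i j (X := 'I_n)).
    have [[[iL jL] ij]|no] := pselect ((i \in L /\ j \in L) /\ i != j).
      by have [n] := Lu i j iL jL ij r; exists n.
    by exists 0 => iL jL ij; case: no.
  have [n nP] := choice (fun p : 'I_k * 'I_k => ex p.1 p.2).
  by exists (fun i j => n (i, j)) => i j; apply: (nP (i, j)).
have iLi i : i \notin L :\ i by rewrite !inE eqxx.
have [N NP] := choice (fun i => rank_flat_epr hF (n i) (iLi i)).
(* The successor makes room for rank 1 on the legs outside [L]. *)
exists (\max_i N i).+1 => X x0 t tr.
have [m [t' [t't t'L]]] := Lr X x0 t; rewrite -t't in tr *.
apply: (spec_compress hF) => i.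
have [iL|iL] := boolP (i \in L); last first.
  exact: leq_trans (rank_flat_indep iL t'L) _.
apply: leqW; apply: leq_trans (leq_bigmax i).
rewrite leqNgt; apply/negP => Ni.
have [|j] := NP i m t' _ Ni; first by rewrite setD1K.
rewrite !inE => /andP[ji jL]; apply/negP; rewrite -ltNge.
by apply: le_lt_trans tr _; apply: nP; rewrite // eq_sym.
Qed.

Lemma spec_of_tensor (d : format k) (T : tensor K d) : (forall i, (1 <= d i)%N) ->
  exists X (x0 : X) (t : legs k X -> K), F T = spec t.
Proof.
move=> d1; pose N := \max_i d i.
have dN i : (d i <= N)%N := leq_bigmax i.
have N0 : (0 < N)%N := leq_trans (d1 (Ordinal k_gt0)) (dN _).
(* [T] extended by zero to the larger format. *)
pose t (x : legs k 'I_N) :=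
  \sum_(y : multi_index d) (\prod_i (y i == x i :> nat)%:R) * T y.
exists 'I_N, (Ordinal N0), t; apply/eqP; rewrite eq_le; apply/andP; split.
  pose h i (a : 'I_(d i)) : 'I_#|'I_N| := enum_rank (widen_ord (dN i) a).
  apply: (spectrum_pullback hF (h := h)) => x.
  rewrite ffunE -[LHS](sum_multi_index_delta x); apply: eq_bigr => y _.
  by congr (_ * _); apply: eq_bigr => i _; rewrite !ffunE enum_rankK.
apply: (spectrum_restriction hF).
exists (fun i => \matrix_(a, b) (b == (enum_val (a : 'I_#|'I_N|) : 'I_N) :> nat)%:R).
apply/ffunP => x; rewrite !ffunE; apply: eq_bigr => y _; congr (_ * _).
by apply: eq_bigr => i _; rewrite mxE !ffunE.
Qed.

End Merging.

(* Well-ordering of the values *)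
From mathcomp Require Import classical_sets.
Local Open Scope classical_set_scope.

Theorem theorem3p1 (R : realType) (K : fieldType) (k : nat) (hk : (2 <= k)%N)
    (F : forall d : format k, tensor K d -> R)
    (hF : asymptotic_spectrum R K k F) :
  (forall A : set R, A `<=` tensor_values F -> A !=set0 ->
     exists m : R, A m /\ (forall v : R, A v -> m <= v)) /\
  (forall u : nat -> R,
     (forall n : nat, tensor_values F (u n)) ->
     (forall n : nat, u n.+1 <= u n) ->
     exists N : nat, forall n : nat, (N <= n)%N -> u n = u N).
Proof.
have k_gt0 : (0 < k)%N by apply: ltnW.
have wf (A : set R) : A `<=` tensor_values F -> A !=set0 ->
    exists m : R, A m /\ (forall v : R, A v -> m <= v).
  (* Without a minimum, [A] contains an infinite descent from [v0]; its values are at most [v0], so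
     they all occur on the common index type ['I_N]. *)
  move=> AF [v0 Av0]; apply: contrapT => nomin.
  have [N hN] := spec_le_bounded_size hF v0.
  have At v : A v -> v <= v0 -> exists t : legs k 'I_N -> K, v = spec F t.
    move=> Av; have [d [T [d1 vE]]] := AF v Av.
    have [X [x0 [t FE]]] := spec_of_tensor k_gt0 hF T d1.
    by rewrite vE FE => /(hN _ x0)[t' <-]; exists t'.
  have dec v : exists w, A v -> A w /\ w < v.
    have [Av|] := pselect (A v); last by exists 0.
    apply: contrapT => /forallNP nodec; apply: nomin; exists v; split=> // w Aw.
    by rewrite leNgt; apply/negP => wv; apply: (nodec w).
  have [next nextP] := choice dec.
  pose u n := iter n next v0.
  have uA n : A (u n) by elim: n => //= n /nextP[].
  have u0 n : u n <= v0.
    by elim: n => //= n IHn; apply: le_trans IHn; apply: ltW; case: (nextP _ (uA n)).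
  have [t tE] := choice (fun n => At _ (uA n) (u0 n)).
  apply: (@spec_no_descent R K k F k_gt0 hF _ t) => n.
  by rewrite -!tE; case: (nextP _ (uA n)).
split=> // u uF u_dec.
(* The sequence is constant from an index at which it attains its minimum. *)
have [|m [[N _ <-] umin]] := wf (range u) _ (ex_intro _ (u 0) (ex_intro2 _ _ 0 I erefl)).
  by move=> _ [n _ <-].
exists N => n Nn; apply/eqP; rewrite eq_le umin ?andbT; last by exists n.
elim: n Nn => [|n IHn]; first by rewrite leqn0 => /eqP->.
by rewrite leq_eqVlt => /orP[/eqP->//|/IHn]; apply: le_trans.
Qed.
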